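(* Let $a,b,c,d\in\mathbb{R}$ and $h\in\mathbb{R}\setminus\{0\}$, and set $\alpha=ah^2$, $\beta=\frac{bh^2}{3}$, $\gamma=1+\frac{ch^2}{3}$, $\delta=dh^2$, $\epsilon=\alpha\delta+\beta(3-\gamma)$, $\zeta=\beta\delta+\gamma(3-\gamma)$. Let $\varphi:(x,y)\mapsto(\overline{x},\overline{y})$ be the rational map of the plane $$\overline{x}=y,\qquad \overline{y}=\frac{(3-\gamma)y-\delta-(\beta y+\gamma)x}{\beta y+\gamma+(\alpha y+\beta)x},$$ let $J(x,y)$ be its Jacobian determinant, and let $$P_1(x,y)=\alpha xy+\beta(x+y)+\gamma,$$ $$P_2(x,y)=(\alpha\gamma-\beta^2)x^2y^2+\epsilon xy(x+y)+\zeta(x^2+y^2)-(3-\gamma)^2xy+(3-\gamma)\delta(x+y)-\delta^2.$$ Then, wherever the expressions involved are defined: (i) $P_k(\overline{x},\overline{y})=J(x,y)\,P_k(x,y)$ for $k=1,2$; (ii) $\varphi$ preserves the symplectic form $\dfrac{dx\wedge dy}{P_1(x,y)}$, i.e. $\dfrac{d\overline{x}\wedge d\overline{y}}{P_1(\overline{x},\overline{y})}=\dfrac{dx\wedge dy}{P_1(x,y)}$; (iii) $P_2/P_1$ is a first integral of $\varphi$, i.e. $\dfrac{P_2(\overline{x},\overline{y})}{P_1(\overline{x},\overline{y})}=\dfrac{P_2(x,y)}{P_1(x,y)}$. Moreover, for fixed $a,b,c,d,x,p$, if $y=x+hp+O(h^2)$ as $h\to0$, then $P_1(x,y)=1+O(h^2)$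 and $P_2(x,y)=4Hh^2+O(h^3)$, where $H=\frac12p^2+\frac14ax^4+\frac13bx^3+\frac12cx^2+dx$.
   Context: The map $\varphi$ is the first-order form (with $(x,y)$ standing for two consecutive iterates) of the second order difference equation $$\frac{\overline{x}-2x+\underline{x}}{h^2}=-a\,\underline{x}\,x\,\overline{x}-\frac{b}{3}(\underline{x}x+\underline{x}\,\overline{x}+x\overline{x})-\frac{c}{3}(\underline{x}+x+\overline{x})-d,$$ which is a discretization, with time step $h$, of the Newton equation $\ddot{x}=-ax^3-bx^2-cx-d$ with Hamiltonian $H$; here $\overline{x},\underline{x}$ denote the approximations to $x(t+h)$ and $x(t-h)$. *)

(* Defs.v *)
From HB Require Import structures.
From mathcomp Require Import all_boot all_order all_algebra.
From mathcomp Require Import all_classical all_reals all_analysis.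

Set Implicit Arguments.
Unset Strict Implicit.
Unset Printing Implicit Defensive.

Import Order.TTheory GRing.Theory Num.Theory.
Import numFieldNormedType.Exports.

Local Open Scope ring_scope.

Definition alpha (R : realType) (a h : R) : R := a * h ^+ 2.
Definition beta (R : realType) (b h : R) : R := b * h ^+ 2 / 3.
Definition gamma (R : realType) (c h : R) : R := 1 + c * h ^+ 2 / 3.
Definition delta (R : realType) (d h : R) : R := d * h ^+ 2.

Definition epsilon (R : realType) (a b c d h : R) : R :=
  alpha a h * delta d h + beta b h * (3 - gamma c h).

Definition zeta (R : realType) (b c d h : R) : R :=
  beta b h * delta d h + gamma c h * (3 - gamma c h).

Definition P1 (R : realType) (a b c h x y : R) : R :=
  alpha a h * x * y + beta b h * (x + y) + gamma c h.

Definition P2 (R : realType) (a b c d h x y : R) : R :=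
  (alpha a h * gamma c h - beta b h ^+ 2) * x ^+ 2 * y ^+ 2
  + epsilon a b c d h * x * y * (x + y)
  + zeta b c d h * (x ^+ 2 + y ^+ 2)
  - (3 - gamma c h) ^+ 2 * x * y
  + (3 - gamma c h) * delta d h * (x + y)
  - delta d h ^+ 2.

Definition ham (R : realType) (a b c d x p : R) : R :=
  p ^+ 2 / 2 + a * x ^+ 4 / 4 + b * x ^+ 3 / 3 + c * x ^+ 2 / 2 + d * x.

(* Points and tangent vectors of the plane are row vectors. *)
Definition pt (R : realType) (x y : R) : 'rV[R]_2 :=
  \row_(j < 2) (if j == 0 then x else y).
Definition fstc (R : realType) (z : 'rV[R]_2) : R := z 0 0.
Definition sndc (R : realType) (z : 'rV[R]_2) : R := z 0 1.

Definition phi_num (R : realType) (b c d h x y : R) : R :=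
  (3 - gamma c h) * y - delta d h - (beta b h * y + gamma c h) * x.
Definition phi_den (R : realType) (a b c h x y : R) : R :=
  beta b h * y + gamma c h + (alpha a h * y + beta b h) * x.

Definition xbar (R : realType) (x y : R) : R := y.
(* Division is total (_ / 0 = 0), so this is the rational map only where
   [phi_den] does not vanish. *)
Definition ybar (R : realType) (a b c d h x y : R) : R :=
  phi_num b c d h x y / phi_den a b c h x y.

Definition phi (R : realType) (a b c d h : R) (z : 'rV[R]_2) : 'rV[R]_2 :=
  pt (xbar (fstc z) (sndc z)) (ybar a b c d h (fstc z) (sndc z)).

(* ['J f z] is the transpose of the usual Jacobian matrix (differentials act on
   row vectors), which does not affect the determinant. *)
Definition Jdet (R : realType) (a b c d h x y : R) : R :=
  \det ('J (phi a b c d h) (pt x y)).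

(* 1-forms and 2-forms are given pointwise: [eta z u] and [omega z u v] with [z]
   the base point and [u], [v] tangent vectors. *)
Definition form1 (R : realType) := 'rV[R]_2 -> 'rV[R]_2 -> R.
Definition form2 (R : realType) := 'rV[R]_2 -> 'rV[R]_2 -> 'rV[R]_2 -> R.

Definition dform (R : realType) (f : 'rV[R]_2 -> R) : form1 R :=
  fun z u => 'd f z u.

Definition wedge (R : realType) (eta theta : form1 R) : form2 R :=
  fun z u v => eta z u * theta z v - eta z v * theta z u.

Definition pullback (R : realType) (f : 'rV[R]_2 -> 'rV[R]_2)
    (omega : form2 R) : form2 R :=
  fun z u v => omega (f z) ('d f z u) ('d f z v).

Definition sympl (R : realType) (a b c h : R) : form2 R :=
  fun z u v => wedge (dform (@fstc R)) (dform (@sndc R)) z u v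
                 / P1 a b c h (fstc z) (sndc z).

(* Main.v *)
Require Import Defs.
From mathcomp Require Import all_boot all_order all_algebra.
From mathcomp Require Import all_classical all_reals all_analysis.
From mathcomp Require Import ring.
Import Order.TTheory GRing.Theory Num.Theory.
Import numFieldNormedType.Exports.
Local Open Scope classical_set_scope.
Local Open Scope ring_scope.

(* The denominator of [ybar] is [P1 x y] itself, so [phi] is smooth where it is
   defined and J = - d(ybar)/dx is a rational function; (i) is then a polynomial
   identity after clearing the powers of [P1].  Since the pull-back of dx /\ dy
   is J dx /\ dy, (ii) and (iii) follow from (i) by cancelling J.  For the
   expansions, write y = x + h s with s = p + h r and r bounded: the remainders
   divided by h^2, resp. h^3, are polynomials in h, y, s and r. *)

Lemma det_mx22 (R : comNzRingType) (A : 'M[R]_2) :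
  \det A = A 0 0 * A 1 1 - A 0 1 * A 1 0.
Proof.
rewrite (expand_det_row _ 0) !big_ord_recl big_ord0 addr0 /cofactor.
rewrite !det_mx11 !mxE /= expr0 expr1 mul1r mulN1r mulrN.
by congr (A _ _ * A _ _ - A _ _ * A _ _); apply: val_inj.
Qed.

(** Exposes scaling of [R] over itself as the product that [ring] and [field] recognise. *)
Lemma scale_reg (R : realType) (k x : R) : k *: x = k * x.
Proof. by []. Qed.

(** * The differential of [phi], its Jacobian, and the invariance statements *)

Section DifferentialOfPhi.
Variables (R : realType) (a b c d h : R).

Lemma fstc_pt (x y : R) : fstc (pt x y) = x.
Proof. by rewrite /fstc /pt mxE. Qed.

Lemma sndc_pt (x y : R) : sndc (pt x y) = y.
Proof. by rewrite /sndc /pt mxE. Qed.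

(** Reduces the differentiation of [phi] to that of its two scalar coordinates, by the sum rule and
    the chain rule with [k *: v] for a fixed vector [v]. *)
Lemma ptE (x y : R) : pt x y = x *: pt 1 0 + y *: pt 0 1.
Proof.
by apply/rowP => j; rewrite !mxE; case: eqP => _;
  rewrite ?mulr1 ?mulr0 ?addr0 ?add0r.
Qed.

Lemma is_diff_coord m n (M : 'M[R]_(m, n)) i j :
  is_diff M (fun N : 'M[R]_(m, n) => N i j) (fun N : 'M[R]_(m, n) => N i j).
Proof.
(* Bundled as a linear map, the coordinate is its own differential, by continuity. *)
have @f : {linear 'M[R]_(m, n) -> R}.
  by exists (fun N : 'M[R]_(_, _) => N i j); do 2![eexists]; do ?[constructor];
     rewrite ?mxE// => ? *; rewrite ?mxE//; move=> ?; rewrite !mxE.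
apply: DiffDef; first exact: differentiable_coord.
by rewrite (_ : (fun _ => _) = f) // diff_lin //; exact: coord_continuous.
Qed.

Lemma is_diff_fstc (z : 'rV[R]_2) : is_diff z (@fstc R) (@fstc R).
Proof. exact: is_diff_coord. Qed.

Lemma is_diff_sndc (z : 'rV[R]_2) : is_diff z (@sndc R) (@sndc R).
Proof. exact: is_diff_coord. Qed.

Lemma is_diff_div (V : normedModType R) (f g df dg : V -> R) (z : V) :
  is_diff z f df -> is_diff z g dg -> g z != 0 ->
  is_diff z (fun w => f w / g w)
    (fun w => (df w * g z - f z * dg w) / g z ^+ 2).
Proof.
move=> dfz dgz gz0.
have dV : is_diff z (fun w => (g w)^-1) (- (g z) ^- 2 *: dg).
  apply: DiffDef; first exact: differentiableV.
  by rewrite diffV // diff_val.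
apply: is_diff_eq (is_diffM dfz dV) _.
by apply/funext => w /=; rewrite !fctE /= !scale_reg; field.
Qed.

Definition den_diff (x y : R) (w : 'rV[R]_2) : R :=
  (alpha a h * y + beta b h) * fstc w + (alpha a h * x + beta b h) * sndc w.

Definition num_diff (x y : R) (w : 'rV[R]_2) : R :=
  (3 - gamma c h - beta b h * x) * sndc w - (beta b h * y + gamma c h) * fstc w.

Definition ybar_diff (x y : R) (w : 'rV[R]_2) : R :=
  (num_diff x y w * phi_den a b c h x y - phi_num b c d h x y * den_diff x y w)
    / phi_den a b c h x y ^+ 2.

(** Numerator and denominator of [ybar] are both affine in each variable, so this one computation
    serves for both. *)
Lemma is_diff_bilin_poly (k0 k1 k2 k3 x y : R) :
  is_diff (pt x y)
    (fun z => k0 + k1 * fstc z + k2 * sndc z + k3 * (fstc z * sndc z))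
    (fun w => (k1 + k3 * y) * fstc w + (k2 + k3 * x) * sndc w).
Proof.
pose dx := is_diff_fstc (pt x y); pose dy := is_diff_sndc (pt x y).
have H := is_diffD (is_diffD (is_diffD (is_diff_cst k0 (pt x y))
  (is_diffZ k1 dx)) (is_diffZ k2 dy)) (is_diffZ k3 (is_diffM dx dy)).
apply: is_diff_eq H _; apply/funext => w.
(* The differential of the constant [k0] is the zero function; its value has to be shown to [ring]
   as a scalar. *)
by rewrite !fctE fstc_pt sndc_pt !scale_reg -[0 w]/(0 : R); ring.
Qed.

Lemma is_diff_ybar (x y : R) : phi_den a b c h x y != 0 ->
  is_diff (pt x y) (fun z => ybar a b c d h (fstc z) (sndc z)) (ybar_diff x y).
Proof.
move=> D0.
have dN : is_diff (pt x y) (fun z => phi_num b c d h (fstc z) (sndc z))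
    (num_diff x y).
  have := is_diff_bilin_poly (- delta d h) (- gamma c h) (3 - gamma c h)
    (- beta b h) x y.
  congr is_diff_def; apply/funext => z; rewrite /phi_num /num_diff; ring.
have dD : is_diff (pt x y) (fun z => phi_den a b c h (fstc z) (sndc z))
    (den_diff x y).
  have := is_diff_bilin_poly (gamma c h) (beta b h) (beta b h) (alpha a h) x y.
  congr is_diff_def; apply/funext => z; rewrite /phi_den /den_diff; ring.
have := is_diff_div _ _ _ _ _ _ dN dD; rewrite !fstc_pt !sndc_pt => /(_ D0).
exact.
Qed.

Lemma is_diff_phi (x y : R) : phi_den a b c h x y != 0 ->
  is_diff (pt x y) (phi a b c d h) (fun w => pt (sndc w) (ybar_diff x y w)).
Proof.
move=> /is_diff_ybar dyb.
have dyb1 := is_diff_comp dyb (is_diff_scalel _ (pt 0 1)).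
have dyb0 := is_diff_comp (is_diff_sndc (pt x y)) (is_diff_scalel _ (pt 1 0)).
have := is_diffD dyb0 dyb1.
by congr is_diff_def; apply/funext => z; rewrite [RHS]ptE.
Qed.

(** As [xbar] is y, the first column of the matrix is (0, 1); only the x-derivative of [ybar]
    survives in the determinant, given by the quotient rule. *)
Lemma JdetE (x y : R) : phi_den a b c h x y != 0 ->
  Jdet a b c d h x y =
    ((beta b h * y + gamma c h) * phi_den a b c h x y
      + phi_num b c d h x y * (alpha a h * y + beta b h))
    / phi_den a b c h x y ^+ 2.
Proof.
move=> D0; rewrite /Jdet det_mx22 /jacobian /lin1_mx !mxE.
rewrite (@diff_val _ _ _ _ _ _ _ (is_diff_phi _ _ D0)).
rewrite !mxE /= /ybar_diff /num_diff /den_diff /fstc /sndc !mxE /=.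
by field.
Qed.

(** With [ybar] = N/D, the left side is ((alpha y + beta) N + (beta y + gamma) D) / D, that is, the
    numerator in [JdetE] over D, and D equals [P1] at (x, y). *)
Lemma P1_phi (x y : R) : phi_den a b c h x y != 0 ->
  P1 a b c h (xbar x y) (ybar a b c d h x y)
    = Jdet a b c d h x y * P1 a b c h x y.
Proof.
move=> D0; rewrite JdetE // /xbar /ybar; move: D0.
rewrite /P1 /phi_num /phi_den.
move: (alpha a h) (beta b h) (gamma c h) (delta d h) => A B C D D0.
by field.
Qed.

Lemma P2_phi (x y : R) : phi_den a b c h x y != 0 ->
  P2 a b c d h (xbar x y) (ybar a b c d h x y)
    = Jdet a b c d h x y * P2 a b c d h x y.
Proof.
move=> D0; rewrite JdetE // /xbar /ybar; move: D0.
rewrite /P2 /epsilon /zeta /phi_num /phi_den.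
(* The identity holds for arbitrary coefficients, so their dependence on a, b, c, d, h is
   forgotten. *)
move: (alpha a h) (beta b h) (gamma c h) (delta d h) => A B C D D0.
by field.
Qed.

Lemma wedge_dform_coord (z u v : 'rV[R]_2) :
  wedge (dform (@fstc R)) (dform (@sndc R)) z u v
    = fstc u * sndc v - fstc v * sndc u.
Proof.
rewrite /wedge /dform (@diff_val _ _ _ _ _ _ _ (is_diff_fstc z)).
by rewrite (@diff_val _ _ _ _ _ _ _ (is_diff_sndc z)).
Qed.

(** The y-derivative of [ybar] cancels by antisymmetry; what remains is its x-derivative, which is
    -J. Both readings of (ii), by pull-back and by differentials of the coordinates of [phi], rest
    on this. *)
Lemma wedge_diff_phi (x y : R) (u v : 'rV[R]_2) : phi_den a b c h x y != 0 ->
  sndc u * ybar_diff x y v - sndc v * ybar_diff x y u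
    = Jdet a b c d h x y * (fstc u * sndc v - fstc v * sndc u).
Proof.
by move=> D0; rewrite JdetE // /ybar_diff /num_diff /den_diff; field.
Qed.

Lemma wedge_dform_phi_coord (x y : R) (u v : 'rV[R]_2) :
  phi_den a b c h x y != 0 ->
  wedge (dform (fun z => fstc (phi a b c d h z)))
        (dform (fun z => sndc (phi a b c d h z))) (pt x y) u v
    = Jdet a b c d h x y * (fstc u * sndc v - fstc v * sndc u).
Proof.
move=> D0; rewrite -wedge_diff_phi // /wedge /dform.
rewrite [fun z => fstc _](_ : _ = @sndc R); last first.
  by apply/funext => z; rewrite /phi fstc_pt.
rewrite [fun z => sndc _](_ : _ = fun z => ybar a b c d h (fstc z) (sndc z));
  last by apply/funext => z; rewrite /phi sndc_pt.
rewrite (@diff_val _ _ _ _ _ _ _ (is_diff_sndc (pt x y))).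
by rewrite (@diff_val _ _ _ _ _ _ _ (is_diff_ybar _ _ D0)).
Qed.

(** The cancellation common to (ii) and (iii), with [k] the value of dx /\ dy or of [P2]. Since [P1]
    at the image is J times [P1], its being nonzero makes both factors nonzero. *)
Lemma Jdet_div_P1 (x y k : R) : phi_den a b c h x y != 0 ->
  P1 a b c h (xbar x y) (ybar a b c d h x y) != 0 ->
  Jdet a b c d h x y * k / P1 a b c h (xbar x y) (ybar a b c d h x y)
    = k / P1 a b c h x y.
Proof.
move=> D0; rewrite P1_phi // mulf_eq0 negb_or => /andP[J0 P0].
by field; rewrite P0.
Qed.

Lemma pullback_sympl (x y : R) : phi_den a b c h x y != 0 ->
  P1 a b c h (xbar x y) (ybar a b c d h x y) != 0 ->
  pullback (phi a b c d h) (sympl a b c h) (pt x y) = sympl a b c h (pt x y).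
Proof.
move=> D0 P0; apply/funext => u; apply/funext => v.
rewrite /pullback /sympl !wedge_dform_coord.
rewrite (@diff_val _ _ _ _ _ _ _ (is_diff_phi _ _ D0)).
rewrite /phi !fstc_pt !sndc_pt wedge_diff_phi //.
exact: Jdet_div_P1.
Qed.

End DifferentialOfPhi.

(** * Algebra of functions bounded along a filter, and big-O remainders *)

Section BoundedNear.
Variables (R : realType) (T : Type) (F : set_system T) (FF : ProperFilter F).
Implicit Types f g : T -> R.

Lemma bounded_near_cst (k : R) : bounded_near (fun=> k) F.
Proof. by apply/ex_bound; exists `|k|; apply: filterE => x /=. Qed.

Lemma bounded_nearD f g : bounded_near f F -> bounded_near g F ->
  bounded_near (fun x => f x + g x) F.
Proof.
move=> /ex_bound[k Hk] /ex_bound[l Hl]; apply/ex_bound; exists (k + l).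
near=> x => /=; rewrite (le_trans (ler_normD _ _))// lerD//; by near: x.
Unshelve. all: by end_near. Qed.

Lemma bounded_nearM f g : bounded_near f F -> bounded_near g F ->
  bounded_near (fun x => f x * g x) F.
Proof.
move=> /ex_bound[k Hk] /ex_bound[l Hl]; apply/ex_bound; exists (k * l).
near=> x => /=; rewrite normrM ler_pM//; by near: x.
Unshelve. all: by end_near. Qed.

Lemma bounded_nearX f n : bounded_near f F ->
  bounded_near (fun x => f x ^+ n) F.
Proof.
move=> bf; elim: n => [|n IHn].
  by under eq_fun do rewrite expr0; exact: bounded_near_cst.
by under eq_fun do rewrite exprS; exact: bounded_nearM.
Qed.

End BoundedNear.

(** Reduces an expansion to naming the quotient of the remainder by [e], checking an exact identity,
    and bounding that quotient. *)
Lemma eqaddO_bounded (R : realType) (T : pointedType) (F : filter_on T)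
    {FF : ProperFilter F} (f g e : T -> R) :
  (f = g +O_ F e) <->
  exists2 q : T -> R, bounded_near q F &
    \forall x \near F, f x = g x + e x * q x.
Proof.
split=> [/eqaddOP/bigO_exP[k k0 Hk]|[q /ex_bound[k Hk] Hq]]; last first.
  (* [bigO_exP] asks for a positive constant, and [k] may be zero. *)
  apply/eqaddOP/bigO_exP; exists (`|k| + 1); first by rewrite ltr_pwDr.
  near=> x; rewrite !fctE.
  have -> : f x = g x + e x * q x by near: x.
  rewrite addrC addKr normrM mulrC ler_wpM2r// (@le_trans _ _ k)//.
    by near: x.
  by rewrite (le_trans (ler_norm k))// lerDl.
exists (fun x => (f x - g x) / e x).
  apply/ex_bound; exists k; apply: filterS Hk => x /=; rewrite !fctE => Hx.
  have [->|e0] := eqVneq (e x) 0; first by rewrite invr0 mulr0 normr0 ltW.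
  by rewrite normrM normfV ler_pdivrMr ?normr_gt0.
apply: filterS Hk => x; rewrite !fctE => Hx.
(* Where [e] vanishes the quotient is 0 by convention, but there the bound itself forces f x = g
   x. *)
have [e0|e0] := eqVneq (e x) 0; last by field.
move: Hx; rewrite e0 normr0 mulr0 normr_le0 subr_eq0 => /eqP ->.
by rewrite mul0r addr0.
Unshelve. all: by end_near. Qed.

(** * Expansions of [P1] and [P2] as h tends to 0 *)

Section Expansions.
Variables (R : realType) (a b c d x p : R) (y : R -> R).
Hypothesis yE : y = (fun h : R => x + h * p) +O_ (0^') (fun h : R => h ^+ 2).

Lemma expansion_remainder : exists r s : R -> R,
  [/\ bounded_near r 0^', bounded_near s 0^',
      bounded_near y 0^', bounded_near id (0^' : set_system R) &
      \forall h \near (0:R)^', y h = x + h * s h /\ s h = p + h * r h].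
Proof.
have [r br Hr] := (eqaddO_bounded _ _ _ _ _ _).1 yE.
have bid : bounded_near id (0^' : set_system R).
  by apply/ex_bound; exists 1; exact: (@dnbhs0_le R R 1 ltr01).
have bs : bounded_near (fun h => p + h * r h) 0^'.
  by apply: bounded_nearD; [exact: bounded_near_cst | exact: bounded_nearM].
have Hy : \forall h \near (0 : R)^', y h = x + h * (p + h * r h).
  by apply: filterS Hr => h ->; ring.
exists r, (fun h => p + h * r h); split=> //; last by apply: filterS Hy.
have : bounded_near (fun h => x + h * (p + h * r h)) 0^'.
  by apply: bounded_nearD; [exact: bounded_near_cst | exact: bounded_nearM].
by apply: sub_boundedl; apply: filterS Hy => h ->.
Qed.

Lemma P1_expansion :
  (fun h : R => P1 a b c h x (y h))
    = (fun _ : R => 1) +O_ (0^') (fun h : R => h ^+ 2).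
Proof.
have [r [s [br bs by0 bid Hy]]] := expansion_remainder.
(* This is (P1 - 1) / h^2, with y left unexpanded. *)
apply/eqaddO_bounded; exists (fun h => a * x * y h + b / 3 * (x + y h) + c / 3).
  by do !(apply: bounded_nearD || apply: bounded_nearM ||
          exact: bounded_near_cst || done).
by near=> h; rewrite /P1 /alpha /beta /gamma; field.
Unshelve. all: by end_near. Qed.

Lemma P2_expansion :
  (fun h : R => P2 a b c d h x (y h)) =
    (fun h : R => 4 * ham a b c d x p * h ^+ 2) +O_ (0^') (fun h : R => h ^+ 3).
Proof.
have [r [s [br bs by0 bid Hy]]] := expansion_remainder.
apply/eqaddO_bounded.
(* This is (P2 - 4 H h^2) / h^3. The terms in a, b, c, d outside the last block are the h^2
   coefficients minus their share of 4H: they vanish at y = x, and y - x = h s supplies the extra h.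
   The kinetic term comes from 2 (y - x)^2 - 2 p^2 h^2 = 2 h^2 (s - p)(s + p) with s - p = h r. The
   last block collects the h^4 coefficients. Minus signs sit on constants, so closure under sums,
   products and powers suffices. *)
exists (fun h => a * x ^+ 2 * s h * (x + y h)
  + 2 * b / 3 * x * s h * (y h + 2 * x)
  + 2 * r h * (s h + p) + c / 3 * s h * (y h + 5 * x) + 2 * d * s h
  + h * ((a * c / 3 - b ^+ 2 / 9) * x ^+ 2 * y h ^+ 2
         + (a * d - b * c / 9) * x * y h * (x + y h)
         + (b * d / 3 - c ^+ 2 / 9) * (x ^+ 2 + y h ^+ 2)
         + - (c ^+ 2 / 9) * x * y h + - (c * d / 3) * (x + y h) + - d ^+ 2)).
  by do !(apply: bounded_nearD || apply: bounded_nearM ||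
          apply: bounded_nearX || exact: bounded_near_cst || done).
near=> h; have [-> ->] : y h = x + h * s h /\ s h = p + h * r h by near: h.
by rewrite /P2 /ham /epsilon /zeta /alpha /beta /gamma /delta; field.
Unshelve. all: by end_near. Qed.

End Expansions.

Theorem mainTheorem2 (R : realType) (a b c d : R) :
  (forall h : R, h != 0 ->
    (* (i) *)
    (forall x y : R, phi_den a b c h x y != 0 ->
       P1 a b c h (xbar x y) (ybar a b c d h x y)
         = Jdet a b c d h x y * P1 a b c h x y
       /\ P2 a b c d h (xbar x y) (ybar a b c d h x y)
         = Jdet a b c d h x y * P2 a b c d h x y)
    (* (ii) *)
    /\ (forall x y : R, phi_den a b c h x y != 0 ->
         P1 a b c h x y != 0 ->
         P1 a b c h (xbar x y) (ybar a b c d h x y) != 0 ->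
         pullback (phi a b c d h) (sympl a b c h) (pt x y)
           = sympl a b c h (pt x y)
         /\ (forall u v : 'rV[R]_2,
              wedge (dform (fun z => fstc (phi a b c d h z)))
                    (dform (fun z => sndc (phi a b c d h z))) (pt x y) u v
                / P1 a b c h (xbar x y) (ybar a b c d h x y)
              = wedge (dform (@fstc R)) (dform (@sndc R)) (pt x y) u v
                / P1 a b c h x y))
    (* (iii) *)
    /\ (forall x y : R, phi_den a b c h x y != 0 ->
         P1 a b c h x y != 0 ->
         P1 a b c h (xbar x y) (ybar a b c d h x y) != 0 ->
         P2 a b c d h (xbar x y) (ybar a b c d h x y)
           / P1 a b c h (xbar x y) (ybar a b c d h x y)
         = P2 a b c d h x y / P1 a b c h x y))
  /\ (* h -> 0, with x and p fixed and y a function of h *)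
  (forall (x p : R) (y : R -> R),
     y = (fun h : R => x + h * p) +O_ (0^') (fun h : R => h ^+ 2) ->
     (fun h : R => P1 a b c h x (y h))
       = (fun _ : R => 1) +O_ (0^') (fun h : R => h ^+ 2)
     /\ (fun h : R => P2 a b c d h x (y h))
       = (fun h : R => 4 * ham a b c d x p * h ^+ 2)
           +O_ (0^') (fun h : R => h ^+ 3)).
Proof.
split=> [h _|x p y yE]; last by split; [exact: P1_expansion yE |
  exact: P2_expansion].
split=> [x y D0|]; first by split; [exact: P1_phi | exact: P2_phi].
split=> [x y D0 _ P0|x y D0 _ P0]; last by rewrite P2_phi // Jdet_div_P1.
split=> [|u v]; first exact: pullback_sympl.
by rewrite wedge_dform_phi_coord // wedge_dform_coord Jdet_div_P1.
Qed.
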